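(* For every positive integer $m$, \[ \mathrm{mon}(\mathcal{B}^{=m})=\mathrm{mon}(\mathcal{B}^{\le m})=\ell_{\frac{2m}{m-1},\infty} \] (with $\ell_{\frac{2m}{m-1},\infty}=\ell_\infty$ for $m=1$).
   Context: For $N\in\mathbb{N}$, $\mathcal{B}_N$ is the space of functions $f\colon\{-1,1\}^N\to\mathbb{R}$ with sup norm and Fourier–Walsh coefficients $\widehat f(S)=2^{-N}\sum_xf(x)x^S$, $x^S=\prod_{n\in S}x_n$, $S\subset\{1,\dots,N\}$. $\mathcal{B}^{=m}=\bigcup_N\{f\in\mathcal{B}_N:\widehat f(S)=0\text{ if }|S|\ne m\}$ and $\mathcal{B}^{\le m}=\bigcup_N\{f\in\mathcal{B}_N:\widehat f(S)=0\text{ if }|S|>m\}$. For $V\subset\bigcup_N\mathcal{B}_N$, $\mathrm{mon}(V)$ is the set of $x\in\mathbb{R}^{\mathbb{N}}$ for which there is $C>0$ with $\sum_{S}|\widehat f(S)x^S|\le C\|f\|_\infty$ for all $f\in V$. For $1\le q<\infty$, $\ell_{q,\infty}$ is the weak-$\ell_q$ (Marcinkiewicz) space of real sequences $x$ with $\sup_n n^{1/q}x^*_n<\infty$, $x^*$ the decreasing rearrangement of $(|x_n|)$. *)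

(* Defs.v *)
From HB Require Import structures.
From mathcomp Require Import all_boot all_order all_algebra.
From mathcomp Require Import all_classical all_reals.
From mathcomp Require Import ereal exp.
Set Implicit Arguments. Unset Strict Implicit. Unset Printing Implicit Defensive.
Import Order.TTheory GRing.Theory Num.Theory.
Local Open Scope ring_scope.
Local Open Scope classical_set_scope.

Section Defs.
Variable R : realType.

(* points of {-1,1}^N : b = true encodes -1, b = false encodes 1 *)
Definition cube (N : nat) := {ffun 'I_N -> bool}.
Definition sgnb (b : bool) : R := if b then -1 else 1.

Definition chi (N : nat) (S : {set 'I_N}) (x : cube N) : R :=
  \prod_(i in S) sgnb (x i).

Definition fourier (N : nat) (f : cube N -> R) (S : {set 'I_N}) : R :=
  (2 ^+ N)^-1 * \sum_(x : cube N) f x * chi S x.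

Definition supnorm (N : nat) (f : cube N -> R) : R :=
  \big[Num.max/0]_(x : cube N) `|f x|.

Definition homog (m N : nat) (f : cube N -> R) : Prop :=
  forall S : {set 'I_N}, #|S| <> m -> fourier f S = 0.
Definition deg_le (m N : nat) (f : cube N -> R) : Prop :=
  forall S : {set 'I_N}, (m < #|S|)%N -> fourier f S = 0.

(* mon(V) for V = union over N of {f in B_N | V N f}; the coordinate x_n of the
   paper (n >= 1) is x (n-1) here, i.e. coordinate i : 'I_N uses x i. *)
Definition mon (V : forall N : nat, (cube N -> R) -> Prop) : set (nat -> R) :=
  [set x | exists C : R, 0 < C /\
     forall (N : nat) (f : cube N -> R), V N f ->
       \sum_(S : {set 'I_N}) `|fourier f S * \prod_(i in S) x (nat_of_ord i)|
         <= C * supnorm f].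

Definition card_lt (A : set nat) (n : nat) : Prop :=
  ~ (exists g : 'I_n -> nat, injective g /\ forall i, A (g i)).

(* decreasing rearrangement x*_n (n >= 1) of (|x_k|)_k, extended-real valued *)
Definition xstar (x : nat -> R) (n : nat) : \bar R :=
  ereal_inf [set s%:E | s in [set s : R | 0 <= s /\ card_lt [set k | s < `|x k|] n]].

Definition weak_l (q : R) : set (nat -> R) :=
  [set x | exists C : R, forall n : nat, (1 <= n)%N ->
     (((n%:R : R) `^ q^-1)%:E * xstar x n <= C%:E)%E].

Definition linfty : set (nat -> R) :=
  [set x | exists C : R, forall n, `|x n| <= C].

Definition target (m : nat) : set (nat -> R) :=
  if m == 1%N then linfty else weak_l ((2 * m)%:R / (m.-1)%:R).

End Defs.

(* Main.v *)
(** If [x] lies in the weak space and [f] has degree at most [m], the Bonami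
    inequality compares the L1 and L2 norms of the partial derivatives of [f],
    and since the sum of their absolute values at a point is a directional
    derivative of the multilinear extension of [f], one gets
    [sum_j (sum_(S containing j) |fhat S|^2)^(1/2) <= K ||f||].  Now group the
    sets [S] by the element [j] at which [|x|] is smallest and apply
    Cauchy-Schwarz inside each group: the weak-space bound on the decreasing
    rearrangement keeps the factor attached to [j] bounded.

    Conversely, if [|x| > s] on a set [A] of [n] indices, random signs on the
    [m]-subsets of [A] give an [m]-homogeneous function of norm
    [O(n^((m+1)/2))] (Kahane-Salem-Zygmund); testing [x] on it yields
    [s = O(n^(-(m-1)/(2m)))]. *)
Require Import Defs.
From HB Require Import structures.
From mathcomp Require Import all_boot all_order all_algebra.
From mathcomp Require Import all_classical all_reals.
From mathcomp Require Import ereal exp.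
From mathcomp Require Import ring lra zify fintype finset sequences.
Import Order.TTheory GRing.Theory Num.Theory.
Local Open Scope ring_scope.
Local Open Scope classical_set_scope.

(** * Finite sums and polynomials *)

Section FiniteSums.
Set Implicit Arguments.
Unset Strict Implicit.
Variable R : realType.

(** Lagrange's identity: the double sum of squared minors is twice the defect [A * B - D ^+ 2]. *)
Lemma cauchy_schwarz_sum (I : finType) (P : pred I) (u v : I -> R) :
  (\sum_(i | P i) u i * v i) ^+ 2 <=
  (\sum_(i | P i) u i ^+ 2) * (\sum_(i | P i) v i ^+ 2).
Proof.
set A := \sum_(i | P i) u i ^+ 2; set B := \sum_(i | P i) v i ^+ 2.
set D := \sum_(i | P i) u i * v i.
have : 0 <= \sum_(i | P i) \sum_(j | P j) (u i * v j - u j * v i) ^+ 2.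
  by apply: sumr_ge0 => i _; apply: sumr_ge0 => j _; exact: sqr_ge0.
suff -> : \sum_(i | P i) \sum_(j | P j) (u i * v j - u j * v i) ^+ 2 =
          2 * (A * B - D ^+ 2) by rewrite pmulr_rge0 // subr_ge0.
have step i : \sum_(j | P j) (u i * v j - u j * v i) ^+ 2 =
    u i ^+ 2 * B + v i ^+ 2 * A - 2 * (u i * v i) * D.
  rewrite !mulr_sumr -!big_split -sumrB /=.
  by apply: eq_bigr => j _; ring.
rewrite (eq_bigr _ (fun i _ => step i)) sumrB big_split /= -!mulr_suml.
by rewrite -mulr_sumr -/A -/B -/D; ring.
Qed.

Lemma sum_setU1 (I : finType) (i : I) (F : {set I} -> R) :
  \sum_(S : {set I}) F S = \sum_(S : {set I} | i \notin S) (F S + F (i |: S)).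
Proof.
rewrite (bigID (fun S : {set I} => i \in S)) /= addrC big_split /=.
congr (_ + _).
rewrite (reindex_onto (fun S : {set I} => i |: S) (fun S => S :\ i)) /=; last first.
  by move=> S iS; rewrite setD1K.
apply: eq_bigl => S; rewrite setU11 /=.
apply/eqP/idP => [<-|iS]; first by rewrite setD11.
by rewrite setU1K.
Qed.

Lemma prod_1D (I : finType) (u : I -> R) :
  \prod_i (1 + u i) = \sum_(S : {set I}) \prod_(i in S) u i.
Proof.
under eq_bigr do rewrite addrC.
rewrite bigA_distr; apply: eq_big => [S|S _]; first by rewrite inE.
by rewrite -big_mkcond.
Qed.

(* Rescaling the weights by [1 + s] turns the truncated sum into a full
   product, which is at most [exp 1]. *)
Lemma truncated_elementary_sum (I : finType) (B : {set I}) (k : nat)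
    (y : I -> R) (s : R) :
  (forall i, 0 <= y i) -> \sum_(i in B) y i <= s ->
  \sum_(T : {set I} | (T \subset B) && (#|T| <= k)%N) \prod_(i in T) y i
    <= expR 1 * (1 + s) ^+ k.
Proof.
move=> y0 ys; pose L := 1 + s.
have s0 : 0 <= s by apply: le_trans ys; exact: sumr_ge0.
have L1 : 1 <= L by rewrite lerDl.
have L0 : 0 < L by apply: lt_le_trans L1.
pose w i := if i \in B then y i / L else 0.
have w0 i : 0 <= w i by rewrite /w; case: ifP => // _; rewrite divr_ge0 // ltW.
have wsum : \sum_i w i <= 1.
  rewrite -big_mkcond /= -mulr_suml ler_pdivrMr // mul1r.
  by rewrite (le_trans ys) // lerDr.
have key : \sum_(T : {set I}) \prod_(i in T) w i <= expR 1.
  rewrite -prod_1D; apply: (@le_trans _ _ (\prod_i expR (w i))).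
    apply: ler_prod => i _; rewrite addr_ge0 //=; exact: expR_ge1Dx.
  by rewrite -expR_sum ler_expR.
apply: (@le_trans _ _ (L ^+ k * \sum_(T : {set I}) \prod_(i in T) w i)); last first.
  by rewrite mulrC ler_wpM2r // exprn_ge0 // ltW.
rewrite mulr_sumr big_mkcond; apply: ler_sum => T _.
case: ifP => [/andP[TB Tk]|_]; last first.
  by rewrite mulr_ge0 ?exprn_ge0 ?prodr_ge0 // ltW.
have -> : \prod_(i in T) y i = L ^+ #|T| * \prod_(i in T) w i.
  rewrite -prodr_const -big_split /=; apply: eq_bigr => i iT.
  by rewrite /w (subsetP TB) // mulrCA mulfV ?mulr1 // gt_eqF.
by rewrite ler_wpM2r ?prodr_ge0 // ler_weXn2l.
Qed.

(* The combination [p(t) - 2^m p(t/2)] has degree [m - 1], and its coefficients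
   dominate those of [p]. *)
Lemma coef_bound (m : nat) : exists K : R, 0 <= K /\
  forall (a : nat -> R) (M : R),
    (forall t : R, 0 <= t <= 1 -> `|\sum_(k < m.+1) a k * t ^+ k| <= M) ->
    forall k, (k <= m)%N -> `|a k| <= K * M.
Proof.
elim: m => [|m [K [K0 IH]]].
  exists 1; split => // a M aM k; rewrite leqn0 => /eqP ->.
  have := aM 0; rewrite lexx ler01 => /(_ isT).
  by rewrite big_ord1 expr0 mulr1 mul1r.
pose c : R := 2 ^+ m.+1.
have c1 : 1 <= c by rewrite exprn_ege1 // ler1n.
pose K1 := K * (1 + c).
have K10 : 0 <= K1 by rewrite mulr_ge0 // addr_ge0 // (le_trans ler01).
exists (1 + (m.+1)%:R * K1 + K1); split.
  by rewrite !addr_ge0 // mulr_ge0.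
move=> a M aM.
have M0 : 0 <= M by apply: le_trans (aM 0 _); rewrite ?normr_ge0 // lexx ler01.
have small k : (k <= m)%N -> `|a k| <= K1 * M.
  move=> km.
  pose b k := a k * (1 - c / 2 ^+ k).
  have bM t : 0 <= t <= 1 -> `|\sum_(k < m.+1) b k * t ^+ k| <= (1 + c) * M.
    move=> /andP[t0 t1].
    have -> : \sum_(k < m.+1) b k * t ^+ k =
       \sum_(k < m.+2) a k * t ^+ k - c * \sum_(k < m.+2) a k * (t / 2) ^+ k.
      rewrite mulr_sumr -sumrB [in RHS]big_ord_recr /= [X in _ = _ + X](_ : _ = 0).
        rewrite addr0; apply: eq_bigr => i _.
        by rewrite /b expr_div_n; ring.
      rewrite expr_div_n -/c.
      have c0 : c != 0 by rewrite gt_eqF // (lt_le_trans ltr01).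
      by field.
    rewrite (le_trans (ler_normB _ _)) // mulrDl mul1r lerD //.
      by apply: aM; rewrite t0 t1.
    rewrite normrM ger0_norm ?(le_trans ler01) // ler_wpM2l ?(le_trans ler01) //.
    by apply: aM; rewrite divr_ge0 //= ler_pdivrMr // mul1r (le_trans t1) // ler1n.
  have := IH b _ bM k km; rewrite mulrA -/K1; apply: le_trans.
  rewrite /b normrM ler_peMr //.
  (* Hence [1 - c / 2 ^+ k] has modulus at least 1, and [b k] dominates [a k]. *)
  have c2 : 2 <= c / 2 ^+ k.
    rewrite ler_pdivlMr ?exprn_gt0 // -exprS; apply: ler_weXn2l => //.
    by rewrite ler1n.
  by rewrite ler0_norm; lra.
(* The top coefficient, cancelled in the combination, is recovered from the value at [t = 1]. *)
move=> k; rewrite leq_eqVlt => /orP[/eqP ->|]; last first.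
  rewrite ltnS => /small /le_trans; apply; rewrite ler_wpM2r //.
  by rewrite lerDr addr_ge0 // mulr_ge0.
have := aM 1; rewrite ler01 lexx => /(_ isT).
under eq_bigr do rewrite expr1n mulr1.
rewrite big_ord_recr /= => h.
have hs : `|\sum_(i < m.+1) a i| <= m.+1%:R * K1 * M.
  rewrite (le_trans (ler_norm_sum _ _ _)) //.
  rewrite (le_trans (y := \sum_(i < m.+1) K1 * M)) //.
    by apply: ler_sum => i _; apply: small; rewrite -ltnS.
  by rewrite sumr_const card_ord -mulrA mulr_natl.
have : `|a m.+1| <= M + m.+1%:R * K1 * M.
  have -> : a m.+1 = (\sum_(i < m.+1) a i + a m.+1) - \sum_(i < m.+1) a i by ring.
  exact: (le_trans (ler_normB _ _) (lerD h hs)).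
move=> /le_trans; apply.
have : 0 <= K1 * M by exact: mulr_ge0.
by lra.
Qed.

(** The product rule at 0: this is the derivative of the monomial of [S] at [u] in the direction
    [y]. *)
Lemma coef1_prod_linear (I : finType) (S : {set I}) (u y : I -> R) :
  (\prod_(i in S) ((u i)%:P + y i *: 'X))`_1 =
  \sum_(j in S) y j * \prod_(i in S :\ j) u i.
Proof.
have [n] := ubnP #|S|; elim: n => // n IH in S *; rewrite ltnS => Sn.
have [->|/set0Pn[j jS]] := eqVneq S set0.
  by rewrite !big_set0 coefC.
rewrite (big_setD1 j) //= (big_setD1 j jS (F := fun j => _ * _)) /=.
rewrite coefM !big_ord_recl big_ord0 /= addr0 !coefD !coefZ !coefC !coefX /=.
rewrite mulr0 mulr1 addr0 add0r subnn subn0 IH; last first.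
  by move: Sn; rewrite (cardsD1 j) jS.
rewrite addrC; congr (_ + _); last first.
  rewrite coef0_prod; congr (_ * _); apply: eq_bigr => i _.
  by rewrite coefD coefZ coefC coefX /= mulr0 addr0.
rewrite mulr_sumr; apply: eq_bigr => k; rewrite !inE => /andP[kj kS].
rewrite mulrCA; congr (_ * _).
rewrite [RHS](big_setD1 j) /=; last by rewrite !inE eq_sym kj.
by congr (_ * _); apply: eq_bigl => i; rewrite !inE; do 2!case: (i == _).
Qed.

Lemma size_prod_linear (I : finType) (S : {set I}) (u y : I -> R) :
  (size (\prod_(i in S) ((u i)%:P + y i *: 'X))%R <= #|S|.+1)%N.
Proof.
have [n] := ubnP #|S|; elim: n => // n IH in S *; rewrite ltnS => Sn.
have [->|/set0Pn[j jS]] := eqVneq S set0.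
  by rewrite !big_set0 size_poly1.
rewrite (big_setD1 j) //= (leq_trans (size_polyMleq _ _)) //.
have h1 : (size ((u j)%:P + y j *: 'X)%R <= 2)%N.
  rewrite (leq_trans (size_polyD _ _)) // geq_max.
  rewrite (leq_trans (size_polyC_leq1 _)) //=.
  by rewrite (leq_trans (size_scale_leq _ _)) // size_polyX.
have h2 : (size (\prod_(i in S :\ j) ((u i)%:P + y i *: 'X))%R <= #|S :\ j|.+1)%N.
  by apply: IH; move: Sn; rewrite (cardsD1 j) jS.
by rewrite (cardsD1 j S) jS add1n; have := leq_add h1 h2; case: (_ + _)%N.
Qed.

End FiniteSums.

(** * Walsh expansions and the Bonami inequality *)

Section CubeAnalysis.
Set Implicit Arguments.
Unset Strict Implicit.
Variables (R : realType) (N : nat).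
Implicit Types (S T : {set 'I_N}) (x : cube N) (f g h : cube N -> R).
Implicit Types (a : {set 'I_N} -> R).

Definition mean f : R := (2 ^+ N)^-1 * \sum_x f x.

Definition walsh a x : R := \sum_(S : {set 'I_N}) a S * chi R S x.

Definition flip (i : 'I_N) x : cube N :=
  [ffun k => if k == i then ~~ x k else x k].

Lemma sgnb_sqr b : sgnb R b * sgnb R b = 1.
Proof. by case: b; rewrite /sgnb ?mulrNN mulr1. Qed.

Lemma normr_sgnb b : `|sgnb R b| = 1.
Proof. by case: b; rewrite /sgnb ?normrN normr1. Qed.

Lemma normr_chi S x : `|chi R S x| = 1.
Proof.
rewrite /chi normr_prod; apply: big1 => i _; exact: normr_sgnb.
Qed.

Lemma chi_setU1 i S x : i \notin S -> chi R (i |: S) x = sgnb R (x i) * chi R S x.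
Proof. by move=> iS; rewrite /chi big_setU1. Qed.

Lemma flipK i : involutive (flip i).
Proof.
by move=> x; apply/ffunP => k; rewrite !ffunE; case: eqP => // _; rewrite negbK.
Qed.

Lemma chi_flip i S x : i \notin S -> chi R S (flip i x) = chi R S x.
Proof.
move=> iS; apply: eq_bigr => k kS; rewrite ffunE.
by case: eqP => // ki; rewrite -ki kS in iS.
Qed.

Lemma mean_flip i f : mean (fun x => f (flip i x)) = mean f.
Proof.
rewrite /mean; congr (_ * _).
by rewrite [RHS](reindex_inj (can_inj (flipK i))).
Qed.

Lemma pow2_gt0 : 0 < (2 : R) ^+ N. Proof. by rewrite exprn_gt0. Qed.
Hint Resolve pow2_gt0 : core.

Lemma mean_le f g : (forall x, f x <= g x) -> mean f <= mean g.
Proof.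
move=> fg; rewrite /mean ler_pM2l ?invr_gt0 //; exact: ler_sum.
Qed.

Lemma mean_ge0 f : (forall x, 0 <= f x) -> 0 <= mean f.
Proof.
by move=> f0; rewrite /mean mulr_ge0 ?invr_ge0 ?exprn_ge0 // sumr_ge0.
Qed.

Lemma eq_mean f g : f =1 g -> mean f = mean g.
Proof. by move=> fg; rewrite /mean; under eq_bigr do rewrite fg. Qed.

Lemma meanD f g : mean (fun x => f x + g x) = mean f + mean g.
Proof. by rewrite /mean big_split mulrDr. Qed.

Lemma meanZ c f : mean (fun x => c * f x) = c * mean f.
Proof. by rewrite /mean -mulr_sumr mulrCA. Qed.

Lemma mean_cst c : mean (fun=> c) = c.
Proof.
rewrite /mean sumr_const card_ffun card_bool card_ord -[c *+ _]mulr_natr natrX.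
by rewrite mulrC mulfK // gt_eqF.
Qed.

Lemma mean_sum (I : finType) (P : pred I) (F : I -> cube N -> R) :
  mean (fun x => \sum_(i | P i) F i x) = \sum_(i | P i) mean (F i).
Proof. by rewrite /mean exchange_big mulr_sumr. Qed.

Lemma mean_cauchy_schwarz f g :
  mean (fun x => f x * g x) ^+ 2 <=
  mean (fun x => f x ^+ 2) * mean (fun x => g x ^+ 2).
Proof.
rewrite /mean exprMn [leRHS]mulrACA -[X in _ <= X * _]expr2 ler_pM2l; last first.
  by rewrite exprn_gt0 // invr_gt0.
exact: cauchy_schwarz_sum.
Qed.

Lemma mean_prod (F : 'I_N -> bool -> R) :
  mean (fun x => \prod_i F i (x i)) = \prod_i ((F i true + F i false) / 2).
Proof.
rewrite /mean -bigA_distr_bigA big_split /= mulrC; congr (_ * _).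
  by apply: eq_bigr => i _; rewrite big_bool.
by rewrite prodr_const card_ord exprVn.
Qed.

(** The mean factors over coordinates, and a coordinate in exactly one of [S] and [T] contributes a
    factor of mean 0. *)
Lemma chi_ortho S T : mean (fun x => chi R S x * chi R T x) = (S == T)%:R.
Proof.
rewrite (eq_mean (g := fun x => \prod_i ((if i \in S then sgnb R (x i) else 1) *
   (if i \in T then sgnb R (x i) else 1)))); last first.
  by move=> x; rewrite big_split /= -!big_mkcond.
rewrite (mean_prod (fun i b => (if i \in S then sgnb R b else 1) *
   (if i \in T then sgnb R b else 1))).
have [->|ST] := eqVneq S T.
  apply: big1 => i _; case: ifP => _; rewrite ?sgnb_sqr ?mulr1.
    by rewrite divff.
  by rewrite divff.
have [i iST] : exists i, (i \in S) != (i \in T).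
  by apply/existsP; apply: contraNT ST => /existsPn e; apply/eqP/setP => i;
    apply/eqP; rewrite -[_ == _]negbK.
rewrite (bigD1 i) //= [X in X * _](_ : _ = 0) ?mul0r //.
by move: iST; case: (i \in S); case: (i \in T) => //= _;
   rewrite /sgnb ?mul1r ?mulr1 addNr mul0r.
Qed.

Lemma fourier_walsh a S : fourier (walsh a) S = a S.
Proof.
rewrite /fourier -/(mean _).
rewrite (eq_mean (g := fun x => \sum_(T : {set 'I_N}) a T * (chi R T x * chi R S x))).
  rewrite mean_sum (bigD1 S) //= big1 ?addr0.
    by rewrite meanZ chi_ortho eqxx mulr1.
  by move=> T /negPf TS; rewrite meanZ chi_ortho TS mulr0.
by move=> x; rewrite /walsh mulr_suml; apply: eq_bigr => T _; rewrite mulrA.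
Qed.

Lemma parseval a : mean (fun x => walsh a x ^+ 2) = \sum_(S : {set 'I_N}) a S ^+ 2.
Proof.
rewrite (eq_mean (g := fun x => \sum_(S : {set 'I_N}) a S * (walsh a x * chi R S x))).
  rewrite mean_sum; apply: eq_bigr => S _; rewrite meanZ expr2.
  by congr (_ * _); exact: (fourier_walsh a S).
move=> x; rewrite expr2 {1}/walsh mulr_suml.
by apply: eq_bigr => S _; rewrite -mulrA; congr (_ * _); rewrite mulrC.
Qed.

Lemma normr_le_supnorm f x : `|f x| <= supnorm f.
Proof. exact: (le_bigmax 0 (fun x => `|f x|)). Qed.

Lemma supnorm_le f (M : R) : 0 <= M -> (forall x, `|f x| <= M) -> supnorm f <= M.
Proof. by move=> M0 fM; apply/bigmax_leP; split. Qed.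

(* The multilinear extension of [f] at [u] is the average of [f] against the
   product probability with mean [u]. *)
Lemma multilinear_ext_bound f (u : 'I_N -> R) : (forall i, `|u i| <= 1) ->
  `|\sum_(S : {set 'I_N}) fourier f S * \prod_(i in S) u i| <= supnorm f.
Proof.
move=> u1.
have -> : \sum_(S : {set 'I_N}) fourier f S * \prod_(i in S) u i =
    mean (fun x => f x * \prod_i (1 + u i * sgnb R (x i))).
  rewrite (eq_mean (g := fun x => \sum_(S : {set 'I_N})
      (\prod_(i in S) u i) * (f x * chi R S x))).
    rewrite mean_sum; apply: eq_bigr => S _.
    by rewrite meanZ mulrC; congr (_ * _).
  move=> x; rewrite prod_1D mulr_sumr; apply: eq_bigr => S _.
  by rewrite big_split /= mulrCA mulrA.
have w0 i b : 0 <= 1 + u i * sgnb R b.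
  rewrite -lerBlDl sub0r lerNl.
  rewrite (le_trans (ler_norm _)) //; last by rewrite normrN normrM normr_sgnb mulr1.
apply: (@le_trans _ _
    (mean (fun x => supnorm f * \prod_i (1 + u i * sgnb R (x i))))).
  rewrite /mean normrM ger0_norm ?invr_ge0 ?exprn_ge0 //.
  rewrite ler_pM2l ?invr_gt0 // (le_trans (ler_norm_sum _ _ _)) //.
  apply: ler_sum => x _; rewrite normrM [X in _ * X]ger0_norm ?prodr_ge0 //.
  by rewrite ler_wpM2r ?prodr_ge0 // normr_le_supnorm.
rewrite meanZ (mean_prod (fun i b => 1 + u i * sgnb R b)) big1 ?mulr1 //.
by move=> i _; rewrite /sgnb mulr1 mulrN1; field.
Qed.

(** Both new expansions are free of coordinate [i], so flipping it only changes the sign of the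
    second term; this drives the induction in [bonami]. *)
Lemma walsh_split (i : 'I_N) a x :
  walsh a x = walsh (fun S => if i \in S then 0 else a S) x +
    sgnb R (x i) * walsh (fun S => if i \in S then 0 else a (i |: S)) x.
Proof.
rewrite /walsh (sum_setU1 i) big_split /= mulr_sumr; congr (_ + _).
  rewrite [RHS](bigID (fun S => i \in S)) /=
    [X in _ = X + _]big1 ?add0r => [|S iS]; last first.
    by rewrite iS mul0r.
  by apply: eq_bigr => S /negPf ->.
rewrite [RHS](bigID (fun S => i \in S)) /=
    [X in _ = X + _]big1 ?add0r => [|S iS]; last first.
  by rewrite iS mul0r mulr0.
by apply: eq_bigr => S iS; rewrite (negPf iS) chi_setU1 // mulrCA.
Qed.

Lemma walsh_flip (i : 'I_N) a x : (forall S, i \in S -> a S = 0) ->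
  walsh a (flip i x) = walsh a x.
Proof.
move=> a0; apply: eq_bigr => S _.
by have [/a0 ->|iS] := boolP (i \in S); rewrite ?mul0r ?chi_flip.
Qed.

(* The weighted form of the (2,4)-hypercontractive inequality carries no degree
   hypothesis, so that it passes directly through the induction on coordinates. *)
Lemma bonami (s : seq 'I_N) a :
  (forall S, a S != 0 -> {subset S <= s}) ->
  mean (fun x => walsh a x ^+ 4) <= (\sum_(S : {set 'I_N}) 3 ^+ #|S| * a S ^+ 2) ^+ 2.
Proof.
elim: s => [|i s IH] in a *.
  move=> aS.
  have a0 S : S != set0 -> a S = 0.
    move=> /set0Pn[k kS]; apply/eqP; apply: contraT => /aS /(_ k kS).
    by rewrite in_nil.
  rewrite (eq_mean (g := fun=> a set0 ^+ 4)); last first.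
    move=> x; rewrite /walsh (bigD1 set0) //= big1; last by move=> S /a0 ->; rewrite mul0r.
    by rewrite /chi big_set0 mulr1 addr0.
  rewrite mean_cst (bigD1 set0) //= big1; last by move=> S /a0 ->; rewrite expr0n mulr0.
  by rewrite cards0 mul1r addr0 -exprM.
move=> aS.
pose b S := if i \in S then 0 else a S.
pose c S := if i \in S then 0 else a (i |: S).
have {}IHb : mean (fun x => walsh b x ^+ 4) <=
    (\sum_(S : {set 'I_N}) 3 ^+ #|S| * b S ^+ 2) ^+ 2.
  apply: IH => S; rewrite /b; case: ifPn => [|iS]; first by rewrite eqxx.
  move=> /aS Ss k kS; have := Ss k kS; rewrite inE => /predU1P[ki|//].
  by rewrite -ki kS in iS.
have {IH}IHc : mean (fun x => walsh c x ^+ 4) <=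
    (\sum_(S : {set 'I_N}) 3 ^+ #|S| * c S ^+ 2) ^+ 2.
  apply: IH => S; rewrite /c; case: ifPn => [|iS]; first by rewrite eqxx.
  move=> /aS Ss k kS; have := Ss k; rewrite !inE kS orbT => /(_ isT) /predU1P[ki|//].
  by rewrite -ki kS in iS.
set G := \sum_(S : {set 'I_N}) _ in IHb; set H := \sum_(S : {set 'I_N}) _ in IHc.
have G0 : 0 <= G by apply: sumr_ge0 => S _; rewrite mulr_ge0 ?sqr_ge0 ?exprn_ge0.
have H0 : 0 <= H by apply: sumr_ge0 => S _; rewrite mulr_ge0 ?sqr_ge0 ?exprn_ge0.
have -> : \sum_(S : {set 'I_N}) 3 ^+ #|S| * a S ^+ 2 = G + 3 * H.
  rewrite (sum_setU1 i) big_split /=; congr (_ + _).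
    rewrite /G [RHS](bigID (fun S => i \in S)) /=
      [X in _ = X + _]big1 ?add0r => [|S]; last first.
      by rewrite /b => ->; rewrite expr0n mulr0.
    by apply: eq_bigr => S /negPf; rewrite /b => ->.
  rewrite /H [X in _ = _ * X](bigID (fun S => i \in S)) /=
    [X in _ = _ * (X + _)]big1 ?add0r => [|S]; last first.
    by rewrite /c => ->; rewrite expr0n mulr0.
  rewrite mulr_sumr; apply: eq_bigr => S iS.
  by rewrite cardsU1 iS add1n exprS /c (negPf iS) mulrA.
(* Cauchy-Schwarz bounds the cross term by the two fourth moments, which the induction controls. *)
have gh : mean (fun x => walsh b x ^+ 2 * walsh c x ^+ 2) <= G * H.
  have m0 : 0 <= mean (fun x => walsh b x ^+ 2 * walsh c x ^+ 2).
    by apply: mean_ge0 => x; rewrite mulr_ge0 ?sqr_ge0.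
  rewrite -ler_sqr ?nnegrE ?m0 ?(mulr_ge0 G0 H0) //.
  rewrite (le_trans (mean_cauchy_schwarz _ _)) // exprMn.
  apply: ler_pM.
  - by apply: mean_ge0 => x; exact: sqr_ge0.
  - by apply: mean_ge0 => x; exact: sqr_ge0.
  - by rewrite (eq_mean (g := fun x => walsh b x ^+ 4)) // => x; rewrite -exprM.
  - by rewrite (eq_mean (g := fun x => walsh c x ^+ 4)) // => x; rewrite -exprM.
have -> : mean (fun x => walsh a x ^+ 4) = mean (fun x => walsh b x ^+ 4) +
    6 * mean (fun x => walsh b x ^+ 2 * walsh c x ^+ 2) + mean (fun x => walsh c x ^+ 4).
  (* Averaging with the flipped point cancels the odd powers of [sgnb R (x i)]. *)
  have : mean (fun x => walsh a x ^+ 4) + mean (fun x => walsh a (flip i x) ^+ 4) =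
      2 * (mean (fun x => walsh b x ^+ 4) +
      6 * mean (fun x => walsh b x ^+ 2 * walsh c x ^+ 2) + mean (fun x => walsh c x ^+ 4)).
    rewrite -meanZ -!meanD -meanZ; apply: eq_mean => x.
    rewrite !(walsh_split i a) -/b -/c !walsh_flip; first last.
    - by move=> S; rewrite /b => ->.
    - by move=> S; rewrite /c => ->.
    rewrite ffunE eqxx.
    by case: (x i); rewrite /sgnb /=; ring.
  by rewrite (mean_flip i (fun x => walsh a x ^+ 4)); lra.
(* It remains that [G^2 + 6 G H + H^2 <= (G + 3 H)^2]; the weight 3 is what absorbs the coefficient
   6. *)
have : 0 <= H ^+ 2 by exact: sqr_ge0.
by move: IHb IHc gh; rewrite sqrrD exprMn; lra.
Qed.

(** The fourth moment is at most [9^d] times the square of the second, so [walsh a] cannot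
    concentrate on few points and its L1 norm is comparable to its L2 norm, which is the left side
    by [parseval]. The factor 4 rounds up 8/3. *)
Lemma l2_le_l1 d a : (forall S, a S != 0 -> (#|S| <= d)%N) ->
  Num.sqrt (\sum_(S : {set 'I_N}) a S ^+ 2) <= 4 * 3 ^+ d * mean (fun x => `|walsh a x|).
Proof.
move=> ad; set v := \sum_(S : {set 'I_N}) _; set t := mean _.
have t0 : 0 <= t by apply: mean_ge0.
have v0 : 0 <= v by apply: sumr_ge0 => S _; exact: sqr_ge0.
have D0 : 0 < (3 : R) ^+ d by rewrite exprn_gt0.
have [->|vn0] := eqVneq v 0.
  by rewrite sqrtr0 mulr_ge0 // mulr_ge0 // ltW.
pose s := Num.sqrt v.
have s0 : 0 < s by rewrite sqrtr_gt0 lt_def vn0.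
have sv : s ^+ 2 = v by rewrite sqr_sqrtr.
have four : mean (fun x => walsh a x ^+ 4) <= (3 ^+ d * v) ^+ 2.
  rewrite (le_trans (bonami (s := enum 'I_N) _)) //.
    by move=> S _ k _; rewrite mem_enum.
  rewrite ler_sqr ?nnegrE; first last.
  - by rewrite mulr_ge0 // ltW.
  - by apply: sumr_ge0 => S _; rewrite mulr_ge0 ?sqr_ge0 ?exprn_ge0.
  rewrite /v mulr_sumr; apply: ler_sum => S _.
  have [->|/ad Sd] := eqVneq (a S) 0; first by rewrite expr0n !mulr0.
  by rewrite ler_wpM2r ?sqr_ge0 // ler_weXn2l // ler1n.
(* [y^2 - y^4 <= |y|], applied to [y = mu * walsh a x] with
   [mu = 1 / (2 3^d s)], then averaged. *)
pose mu := (2 * 3 ^+ d * s)^-1.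
have mu0 : 0 < mu by rewrite invr_gt0 !mulr_gt0.
have : mu ^+ 2 * v - mu ^+ 4 * (3 ^+ d * v) ^+ 2 <= mu * t.
  apply: (@le_trans _ _ (mu ^+ 2 * v - mu ^+ 4 * mean (fun x => walsh a x ^+ 4))).
    by rewrite lerD2l lerN2 ler_pM2l // exprn_gt0.
  rewrite -mulNr /v -parseval /t -!meanZ -meanD; apply: mean_le => x.
  set y := walsh a x.
  have -> : mu * `|y| = `|mu * y| by rewrite normrM (gtr0_norm mu0).
  have -> : mu ^+ 2 * y ^+ 2 + - mu ^+ 4 * y ^+ 4 =
     `|mu * y| ^+ 2 - `|mu * y| ^+ 2 * `|mu * y| ^+ 2.
    by rewrite real_normK ?num_real //; ring.
  have : 0 <= `|mu * y| by [].
  move: `|mu * y| => z z0.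
  have [z1|z1] := lerP z 1.
    have : z ^+ 2 <= z by rewrite expr2 ler_piMr.
    by have := sqr_ge0 (z ^+ 2); rewrite expr2; lra.
  have z2 : 1 <= z ^+ 2 by rewrite exprn_ege1 // ltW.
  have : z ^+ 2 <= z ^+ 2 * z ^+ 2 by rewrite ler_peMr // sqr_ge0.
  by lra.
have -> : mu ^+ 2 * v - mu ^+ 4 * (3 ^+ d * v) ^+ 2 = mu * (3 / 8 / 3 ^+ d * s).
  by rewrite -sv /mu; field; rewrite !gt_eqF.
rewrite ler_pM2l // -/s => h.
have : s / 3 ^+ d * (3 / 8) <= t by move: h; congr (_ <= _); field; rewrite gt_eqF.
have : 0 <= s / 3 ^+ d by rewrite divr_ge0 // ltW.
move=> h1 h2; have : s / 3 ^+ d <= 4 * t by lra.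
by rewrite ler_pdivrMr // mulrAC.
Qed.

End CubeAnalysis.

(** * The mixed inequality *)

Section MixedInequality.
Set Implicit Arguments.
Unset Strict Implicit.
Variable R : realType.

(* [walsh (partial_coef f j)] is the [j]-th partial derivative at [x / 2] of the
   multilinear extension of [f], up to a factor 2. *)
Definition partial_coef N (f : cube N -> R) (j : 'I_N) (T : {set 'I_N}) : R :=
  if j \in T then 0 else fourier f (j |: T) / 2 ^+ #|j |: T|.

(** Moving from [x / 2] in the direction of the signs of the partial derivatives turns the
    multilinear extension into a polynomial in [t] of degree at most [m], whose linear coefficient
    is the sum to be bounded; [coef_bound] applies. Halving keeps [(x + t y) / 2] where the
    extension is bounded by [supnorm f]. *)
Lemma sum_partials_bound (m : nat) : (0 < m)%N -> exists K : R, 0 <= K /\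
  forall N (f : cube N -> R), deg_le m f -> forall x : cube N,
    \sum_j `|walsh (partial_coef f j) x| <= K * supnorm f.
Proof.
move=> m0; have [K [K0 HK]] := coef_bound R m.
exists K; split=> // N f fm x.
pose y j := Num.sg (walsh (partial_coef f j) x).
have y1 j : `|y j| <= 1 by rewrite normr_sg lern1 leq_b1.
pose u (i : 'I_N) := sgnb R (x i).
pose c (S : {set 'I_N}) := fourier f S / 2 ^+ #|S|.
pose p := \sum_(S : {set 'I_N}) c S *: \prod_(i in S) ((u i)%:P + y i *: 'X).
have sp : (size p <= m.+1)%N.
  rewrite (leq_trans (size_sum _ _ _)) //; apply/bigmax_leqP => S _.
  have [Sm|Sm] := leqP #|S| m; last first.
    by rewrite /c fm // mul0r scale0r size_poly0.
  rewrite (leq_trans (size_scale_leq _ _)) //.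
  by rewrite (leq_trans (size_prod_linear _ _ _)).
have pM t : 0 <= t <= 1 -> `|\sum_(k < m.+1) p`_k * t ^+ k| <= supnorm f.
  move=> /andP[t0 t1]; rewrite -horner_coef_wide //.
  have -> : p.[t] = \sum_(S : {set 'I_N}) fourier f S *
      \prod_(i in S) ((u i + t * y i) / 2).
    rewrite /p horner_sum; apply: eq_bigr => S _.
    rewrite hornerZ horner_prod /c big_split /= prodr_const exprVn.
    rewrite -mulrA; congr (_ * _); rewrite mulrC; congr (_ * _).
    by apply: eq_bigr => i _; rewrite hornerD hornerC hornerZ hornerX mulrC.
  apply: multilinear_ext_bound => i.
  rewrite normrM [X in _ * X]ger0_norm ?invr_ge0 // ler_pdivrMr // mul1r.
  rewrite (le_trans (ler_normD _ _)) // normr_sgnb -[2](@natrD _ 1 1) lerD //.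
  by rewrite normrM ger0_norm // mulr_ile1.
have := HK _ _ pM 1%N m0; apply: le_trans.
suff -> : p`_1 = \sum_j `|walsh (partial_coef f j) x| by exact: ler_norm.
rewrite coef_sum.
under eq_bigr do rewrite coefZ coef1_prod_linear mulr_sumr.
rewrite (exchange_big_dep xpredT) //=; apply: eq_bigr => j _.
rewrite normrEsg -/(y j) /walsh mulr_sumr.
rewrite big_mkcond /= (sum_setU1 j) [RHS](bigID (fun S : {set 'I_N} => j \in S)) /=.
rewrite [X in _ = X + _]big1 ?add0r; last first.
  by move=> S jS; rewrite /partial_coef jS mul0r mulr0.
apply: eq_bigr => S jS; rewrite (negPf jS) setU11 add0r setU1K //.
by rewrite /partial_coef (negPf jS) -/(c _) mulrCA.
Qed.

(** Up to scaling, each square root is the L2 norm of a partial derivative, so [l2_le_l1] passes to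
    L1 norms; the sum over [j] then moves inside the mean, where the pointwise bound applies. The
    factor [2 ^+ m] undoes the powers of 2 in [partial_coef]. *)
Lemma mixed_l1_l2 (m : nat) : (0 < m)%N -> exists K : R, 0 <= K /\
  forall N (f : cube N -> R), deg_le m f ->
    \sum_j Num.sqrt (\sum_(T : {set 'I_N} | j \notin T) fourier f (j |: T) ^+ 2)
      <= K * supnorm f.
Proof.
move=> m0; have [K [K0 HK]] := sum_partials_bound m0.
exists (2 ^+ m * (4 * 3 ^+ m) * K); split=> [|N f fm].
  by rewrite !mulr_ge0 ?exprn_ge0.
apply: (@le_trans _ _ (\sum_(j : 'I_N) 2 ^+ m * (4 * 3 ^+ m) *
    mean (fun x => `|walsh (partial_coef f j) x|))); last first.
  rewrite -mulr_sumr -[leRHS]mulrA ler_wpM2l ?mulr_ge0 ?exprn_ge0 //.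
  rewrite -(mean_sum xpredT (fun j x => `|walsh (partial_coef f j) x|)).
  rewrite -[leRHS](mean_cst N); apply: mean_le => x; exact: HK.
apply: ler_sum => j _.
have bd T : partial_coef f j T != 0 -> (#|T| <= m)%N.
  rewrite /partial_coef; case: ifPn => [|jT]; first by rewrite eqxx.
  apply: contraR; rewrite -ltnNge => mT.
  by rewrite fm ?mul0r // cardsU1 jT ltnW.
rewrite -mulrA.
have p2 : 0 <= (2 : R) ^+ m by rewrite exprn_ge0.
apply: le_trans (ler_wpM2l p2 (l2_le_l1 bd)).
have -> : (2 : R) ^+ m = Num.sqrt ((2 ^+ m) ^+ 2).
  by rewrite sqrtr_sqr ger0_norm // exprn_ge0.
rewrite -sqrtrM ?sqr_ge0 // ler_wsqrtr // mulr_sumr.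
rewrite [leRHS](bigID (fun T : {set 'I_N} => j \in T)) /=.
rewrite -[leLHS]add0r lerD //.
  by apply: sumr_ge0 => T _; rewrite mulr_ge0 ?sqr_ge0.
apply: ler_sum => T jT; rewrite /partial_coef (negPf jT).
have [Tm|Tm] := leqP #|j |: T| m; last by rewrite fm // mul0r expr0n mulr0.
rewrite expr_div_n mulrCA ler_peMr ?sqr_ge0 //.
rewrite ler_pdivlMr ?exprn_gt0 // mul1r ler_sqr ?nnegrE ?exprn_ge0 //.
by rewrite ler_weXn2l // ler1n.
Qed.

End MixedInequality.

(** * From the weak space to mon *)

Section UpperInclusion.
Set Implicit Arguments.
Unset Strict Implicit.
Variable R : realType.

Definition nroot (m n : nat) : R := n%:R `^ (m%:R^-1).

Lemma nroot_ge0 m n : 0 <= nroot m n.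
Proof. exact: powR_ge0. Qed.

Lemma nroot_expn m n : (0 < m)%N -> nroot m n ^+ m = n%:R.
Proof.
move=> m0; rewrite -powR_mulrn ?nroot_ge0 // -powRrM mulVf ?powRr1 //.
by rewrite pnatr_eq0 -lt0n.
Qed.

Lemma nroot_le m k n : (k <= n)%N -> nroot m k <= nroot m n.
Proof.
move=> kn; apply: ge0_ler_powR; rewrite ?nnegrE ?invr_ge0 ?ler_nat //.
Qed.

Lemma nroot_ge1 m n : 1 <= nroot m n.+1.
Proof. by have := @nroot_le m 1 n.+1 isT; rewrite {1}/nroot powR1. Qed.

(** With [q = 2m / (m - 1)], both sides are [n] to the power [(m - 1) / m]; integer powers of
    [nroot] keep the estimates algebraic. For [m = 1] the convention [1 / 0 = 0] makes both sides 1,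
    which fits the space of bounded sequences. *)
Lemma weight_sqr m n :
  (n%:R `^ ((2 * m)%:R / (m.-1)%:R)^-1) ^+ 2 = nroot m n ^+ m.-1 :> R.
Proof.
rewrite -(powR_mulrn 2 (powR_ge0 _ _)) -(powR_mulrn m.-1 (nroot_ge0 m n)) -!powRrM.
congr (_ `^ _).
by rewrite invf_div natrM invfM [2^-1 * _]mulrC mulrA mulfVK // mulrC.
Qed.

(** Telescoping: for consecutive roots [b <= a], the identity [a^m - b^m = 1] factors into [a - b]
    times [m] terms, each at most [a^(m-1)]. *)
Lemma sum_nroot_inv m n : (0 < m)%N ->
  \sum_(k < n) (nroot m k.+1 ^+ m.-1)^-1 <= m%:R * nroot m n.
Proof.
move=> m0; elim: n => [|n IH]; first by rewrite big_ord0 mulr_ge0 ?nroot_ge0.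
rewrite big_ord_recr /=.
set a := nroot m n.+1; set b := nroot m n in IH *.
have a1 : 1 <= a by exact: nroot_ge1.
have a0 : 0 < a by apply: lt_le_trans a1.
have b0 : 0 <= b by exact: nroot_ge0.
have ba : b <= a by exact: nroot_le.
have step : (a ^+ m.-1)^-1 <= m%:R * (a - b).
  have e : a ^+ m - b ^+ m = 1 by rewrite !nroot_expn // -natrB // subSnn.
  rewrite -div1r ler_pdivrMr ?exprn_gt0 // -[leLHS]e subrXX [leRHS]mulrAC [leRHS]mulrC.
  rewrite ler_wpM2l ?subr_ge0 //.
  apply: (@le_trans _ _ (\sum_(i < m) a ^+ m.-1)); last first.
    by rewrite sumr_const card_ord mulr_natl.
  apply: ler_sum => i _.
  have -> : a ^+ m.-1 = a ^+ (m.-1 - i) * a ^+ i.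
    by rewrite -exprD; congr (_ ^+ _); have := ltn_ord i; lia.
  by rewrite ler_wpM2l ?exprn_ge0 ?(ltW a0) // lerXn2r // nnegrE ltW.
by move: IH step; lra.
Qed.

Lemma sum_injective_le (I : finType) (r : I -> nat) (n : nat) (g : nat -> R) :
  injective r -> (forall k, 0 <= g k) ->
  \sum_(i | (r i < n)%N) g (r i) <= \sum_(k < n) g k.
Proof.
move=> rinj g0.
have -> : \sum_(i | (r i < n)%N) g (r i) =
    \sum_i \sum_(k < n | r i == k) g k.
  rewrite big_mkcond; apply: eq_bigr => i _; case: ifPn => [rn|rn].
    by rewrite (big_pred1 (Ordinal rn)) // => k; rewrite eq_sym.
  by rewrite big_pred0 // => k; apply: contraNF rn => /eqP ->.
rewrite (exchange_big_dep xpredT) //=; apply: ler_sum => k _.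
have [i /eqP ik|none] := pickP (fun i => r i == k); last by rewrite big_pred0.
by rewrite (big_pred1 i) // => j; rewrite /= -ik (inj_eq rinj).
Qed.

(** A nonempty [S] is counted under its element [j] of largest rank, all others having smaller
    ranks. When ranks follow decreasing [|x|], this [j] minimises [|x|] on [S]. *)
Lemma sum_by_top (I : finType) (r : I -> nat) (F : {set I} -> R) :
  injective r -> (forall S, 0 <= F S) ->
  \sum_(S : {set I}) F S <=
  F set0 + \sum_j \sum_(T : {set I} | T \subset [set i | (r i < r j)%N]%SET) F (j |: T).
Proof.
move=> rinj F0; pose B j := [set i | (r i < r j)%N]%SET.
have jB j : j \notin B j by rewrite inE ltnn.
have step j : \sum_(T : {set I} | T \subset B j) F (j |: T) =
    \sum_(S : {set I} | (j \in S) && (S :\ j \subset B j)) F S.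
  rewrite [RHS](reindex_onto (fun T : {set I} => j |: T) (fun S => S :\ j)) /=.
    apply: eq_bigl => T; rewrite setU11 /=.
    apply/idP/andP => [TB|[h /eqP e]]; last by rewrite e in h.
    have jT : j \notin T by apply: contra (jB j); exact: (fintype.subsetP TB).
    by rewrite setU1K.
  by move=> S /andP[jS _]; rewrite setD1K.
rewrite (eq_bigr _ (fun j _ => step j)) (exchange_big_dep xpredT) //=.
rewrite (bigD1 set0) //= lerD2l [leLHS]big_mkcond; apply: ler_sum => S _ /=.
case: ifPn => [/set0Pn[i0 i0S]|_]; last exact: sumr_ge0.
case: (arg_maxnP r i0S) => j jS jmax.
rewrite (bigD1 j) /=; first by rewrite lerDl sumr_ge0.
apply/andP; split=> //; apply/fintype.subsetP => i; rewrite !inE => /andP[ij iS].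
rewrite ltn_neqAle (inj_eq rinj) ij; exact: jmax.
Qed.

Lemma cauchy_schwarz_sqrt (I : finType) (P : pred I) (u v : I -> R) :
  \sum_(i | P i) u i * v i <=
  Num.sqrt (\sum_(i | P i) u i ^+ 2) * Num.sqrt (\sum_(i | P i) v i ^+ 2).
Proof.
have p0 (w : I -> R) : 0 <= \sum_(i | P i) w i ^+ 2.
  by apply: sumr_ge0 => i _; exact: sqr_ge0.
rewrite -sqrtrM // (le_trans (ler_norm _)) // -sqrtr_sqr ler_wsqrtr //.
exact: cauchy_schwarz_sum.
Qed.

(** The first [N] coordinates are ranked by decreasing [|x|], starting from 0, whence the [.+1]. For
    [m = 1] the weight is 1 and any injection serves. *)
Lemma target_rank (m : nat) (x : nat -> R) : target m x -> exists C : R, 0 <= C /\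
  forall N, exists r : 'I_N -> nat, injective r /\
    forall i : 'I_N, x i ^+ 2 * nroot m (r i).+1 ^+ m.-1 <= C.
Proof.
rewrite /target; case: eqP => [->|_] [C xC].
  exists (C ^+ 2); split; first exact: sqr_ge0.
  move=> N; exists (@nat_of_ord N); split; first exact: ord_inj.
  move=> i; rewrite mulr1 -real_normK ?num_real // ler_sqr ?nnegrE ?normr_ge0 //.
  exact: le_trans (xC i).
exists (C ^+ 2); split; first exact: sqr_ge0.
move=> N; pose ge (i j : 'I_N) := `|x j| <= `|x i|.
pose s := sort ge (enum 'I_N).
have ms i : i \in s by rewrite mem_sort mem_enum.
have us : uniq s by rewrite sort_uniq enum_uniq.
have ss : sorted ge s by apply: sort_sorted => i j; exact: le_total.
exists (fun i => index i s); split=> [i j ij|i].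
  by rewrite -(nth_index i (ms i)) ij nth_index.
(* A level below [|x i|] is exceeded at [i] and at every coordinate ranked before it, which is too
   many for it to be admissible in [xstar]. *)
have : (`|x i|%:E <= xstar x (index i s).+1)%E.
  apply: le_ereal_inf_tmp => _ /= [t [t0 tn] <-]; rewrite lee_fin leNgt.
  apply/negP => tx; apply: tn.
  have lti : (index i s < size s)%N by rewrite index_mem.
  exists (fun k : 'I_(index i s).+1 => nat_of_ord (nth i s k)); split.
    move=> k l /ord_inj /eqP; rewrite nth_uniq //; first by move/eqP/ord_inj.
    - exact: leq_trans (ltn_ord k) _.
    - exact: leq_trans (ltn_ord l) _.
  move=> k /=; apply: lt_le_trans tx _.
  have := @sorted_leq_nth _ ge _ _ i s ss k (index i s).
  rewrite nth_index // !inE lti; apply => //.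
  - by move=> a b c; rewrite /ge => ab bc; exact: le_trans bc ab.
  - by move=> a; rewrite /ge.
  - exact: leq_trans (ltn_ord k) _.
  - by rewrite -ltnS.
set n := (index i s).+1 => xn.
have w0 : 0 <= (n%:R : R) `^ ((2 * m)%:R / (m.-1)%:R)^-1 by exact: powR_ge0.
have : (((n%:R : R) `^ ((2 * m)%:R / (m.-1)%:R)^-1)%:E * `|x i|%:E <= C%:E)%E.
  apply: le_trans (xC n isT); apply: lee_wpmul2l => //; rewrite lee_fin //.
rewrite -EFinM lee_fin => h.
rewrite -weight_sqr -/n -[x i ^+ 2]real_normK ?num_real // mulrC -exprMn.
by rewrite ler_sqr ?nnegrE ?mulr_ge0 //; apply: le_trans h; rewrite mulr_ge0.
Qed.

(** Within the group of [j], Cauchy-Schwarz separates coefficients from monomials: the coefficient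
    factors add up over [j] by [mixed_l1_l2], and each monomial factor is at most [Num.sqrt D]. *)
Lemma target_sub_mon (m : nat) (x : nat -> R) : (0 < m)%N ->
  target m x -> mon (fun N (f : cube N -> R) => deg_le m f) x.
Proof.
move=> m0 /target_rank[C [C0 HC]].
have [K [K0 HK]] := mixed_l1_l2 R m0.
(* [C] bounds [x j ^+ 2] times the weight of [j]; the other factor bounds the sum over [T] once that
   weight is divided out. *)
pose D := C * (expR 1 * (1 + C * m%:R) ^+ m.-1).
have Cm0 : 0 <= C * m%:R by rewrite mulr_ge0.
have D0 : 0 <= D by rewrite !mulr_ge0 ?expR_ge0 ?exprn_ge0 // addr_ge0.
exists (1 + Num.sqrt D * K); split.
  by rewrite ltr_pwDl // mulr_ge0 // sqrtr_ge0.
move=> N f fm; have [r [rinj rC]] := HC N.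
pose xs (S : {set 'I_N}) := \prod_(i in S) x (nat_of_ord i).
apply: le_trans (sum_by_top (F := fun S => `|fourier f S * xs S|) rinj _) _.
  by move=> S; exact: normr_ge0.
rewrite mulrDl mul1r lerD //.
  (* The coefficient of the empty set is the multilinear extension at 0. *)
  rewrite /xs big_set0 mulr1.
  have := multilinear_ext_bound f (u := fun=> 0).
  rewrite (bigD1 set0) //= big_set0 mulr1 big1 ?addr0; first by apply=> i; rewrite normr0.
  by move=> S /set0Pn[i iS]; rewrite (bigD1 i) //= mul0r mulr0.
rewrite -mulrA; apply: (@le_trans _ _ (Num.sqrt D *
  \sum_j Num.sqrt (\sum_(T : {set 'I_N} | j \notin T) fourier f (j |: T) ^+ 2))).
  2: by rewrite ler_wpM2l ?sqrtr_ge0 // HK.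
rewrite mulr_sumr; apply: ler_sum => j _.
pose B := [set i | (r i < r j)%N]%SET; rewrite -/B.
have jB : j \notin B by rewrite inE ltnn.
have jT (T : {set 'I_N}) : T \subset B -> j \notin T.
  by move=> TB; apply: contra jB; exact: (fintype.subsetP TB).
pose P (T : {set 'I_N}) := (T \subset B) && (#|T| <= m.-1)%N.
(* The degree bound leaves only [T] with at most [m.-1] elements, so the power of [nroot] produced
   below is exactly the weight of [j]. *)
have -> : \sum_(T : {set 'I_N} | T \subset B) `|fourier f (j |: T) * xs (j |: T)| =
    `|x j| * \sum_(T : {set 'I_N} | P T) `|fourier f (j |: T)| * `|xs T|.
  rewrite mulr_sumr /P big_mkcondr /=; apply: eq_bigr => T TB.
  case: leqP => [_|Tm]; first by rewrite /xs big_setU1 ?jT //= !normrM mulrCA.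
  by rewrite fm ?mul0r ?normr0 // cardsU1 jT // add1n ltnS -(prednK m0).
have y2 : \sum_(T : {set 'I_N} | P T) `|xs T| ^+ 2 <=
    expR 1 * (1 + C * (m%:R * nroot m (r j).+1)) ^+ m.-1.
  have -> : \sum_(T : {set 'I_N} | P T) `|xs T| ^+ 2 =
      \sum_(T : {set 'I_N} | P T) \prod_(i in T) (x i ^+ 2).
    by apply: eq_bigr => T _; rewrite real_normK ?num_real // prodrXl.
  apply: truncated_elementary_sum => [i|]; first exact: sqr_ge0.
  (* The elements of [B] have distinct ranks below [r j], so their squares are summed against the
     weights by [sum_nroot_inv]. *)
  pose g k : R := (nroot m k.+1 ^+ m.-1)^-1.
  have g0 k : 0 <= g k by rewrite invr_ge0 exprn_ge0 // nroot_ge0.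
  apply: (@le_trans _ _ (\sum_(i in B) C * g (r i))).
    apply: ler_sum => i _; rewrite ler_pdivlMr ?rC // exprn_gt0 //.
    exact: lt_le_trans (nroot_ge1 _ _).
  rewrite -mulr_sumr ler_wpM2l //.
  apply: (@le_trans _ _ (\sum_(k < r j) g k)).
    apply: le_trans (sum_injective_le _ rinj g0); rewrite le_eqVlt; apply/orP; left.
    by apply/eqP; apply: eq_bigl => i; rewrite inE.
  apply: le_trans (sum_nroot_inv _ m0) _; rewrite ler_wpM2l //; exact: nroot_le.
have b2 : \sum_(T : {set 'I_N} | P T) `|fourier f (j |: T)| ^+ 2 <=
    \sum_(T : {set 'I_N} | j \notin T) fourier f (j |: T) ^+ 2.
  rewrite [leLHS]big_mkcond [leRHS]big_mkcond; apply: ler_sum => T _.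
  case: ifPn => [/andP[TB _]|_]; first by rewrite jT // real_normK ?num_real.
  by case: ifP => // _; exact: sqr_ge0.
apply: le_trans (ler_wpM2l (normr_ge0 _) (cauchy_schwarz_sqrt _ _ _)) _.
rewrite mulrCA mulrC; apply: ler_pM; rewrite ?mulr_ge0 ?sqrtr_ge0 ?normr_ge0 //.
  2: exact: ler_wsqrtr.
rewrite -sqrtr_sqr -sqrtrM ?sqr_ge0 // ler_wsqrtr //.
apply: le_trans (ler_wpM2l (sqr_ge0 _) y2) _.
set a := nroot m (r j).+1.
have a1 : 1 <= a by exact: nroot_ge1.
(* Since [a >= 1], it factors out of [1 + C m a]; the growth [a^(m-1)] then cancels against the
   decay of [x j ^+ 2]. *)
apply: (@le_trans _ _ (x j ^+ 2 * (expR 1 * (a * (1 + C * m%:R)) ^+ m.-1))).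
  rewrite ler_wpM2l ?sqr_ge0 // ler_wpM2l ?expR_ge0 // lerXn2r // ?nnegrE.
  - by rewrite addr_ge0 // !mulr_ge0 // nroot_ge0.
  - by rewrite mulr_ge0 ?nroot_ge0 // addr_ge0.
  - by rewrite mulrDr mulr1 lerD // mulrA mulrC.
rewrite exprMn /D.
have := rC j; rewrite -/a => ra.
have -> : x j ^+ 2 * (expR 1 * (a ^+ m.-1 * (1 + C * m%:R) ^+ m.-1)) =
  (x j ^+ 2 * a ^+ m.-1) * (expR 1 * (1 + C * m%:R) ^+ m.-1) by ring.
by rewrite ler_wpM2r // mulr_ge0 ?expR_ge0 ?exprn_ge0 // addr_ge0.
Qed.

End UpperInclusion.

(** * From mon to the weak space *)

Section LowerInclusion.
Set Implicit Arguments.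
Unset Strict Implicit.
Variable R : realType.

(** A crude form of [cosh t <= exp (t^2 / 2)] drawn from [1 + y <= exp y] alone: the left side is at
    most [2 / (1 - t^2)]. *)
Lemma expR_pair_le (t : R) : 0 <= t -> t ^+ 2 <= 1 / 2 ->
  expR t + expR (- t) <= 2 * expR (2 * t ^+ 2).
Proof.
move=> t0 t2.
have t1 : t < 1.
  by rewrite -(ltr_pXn2r (n := 2)) ?nnegrE // expr1n; lra.
have e1 : expR t <= (1 - t)^-1.
  rewrite -[t in leLHS]opprK expRN lef_pV2 ?posrE ?expR_gt0 ?subr_gt0 //.
  exact: expR_ge1Dx.
have e2 : expR (- t) <= (1 + t)^-1.
  by rewrite expRN lef_pV2 ?posrE ?expR_gt0 ?expR_ge1Dx //; lra.
apply: (le_trans (lerD e1 e2)).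
apply: (@le_trans _ _ (2 * (1 + 2 * t ^+ 2))); last first.
  by rewrite ler_wpM2l // expR_ge1Dx.
have -> : (1 - t)^-1 + (1 + t)^-1 = 2 / (1 - t ^+ 2).
  by field; rewrite !gt_eqF //; first (by lra); rewrite -?expr2; lra.
have t3 : 0 < 1 - t ^+ 2 by lra.
rewrite ler_pM2l // -[_^-1]div1r ler_pdivrMr //.
have := mulr_ge0 (sqr_ge0 t) (_ : 0 <= 1 - 2 * t ^+ 2).
by move=> h; have := h ltac:(lra); lra.
Qed.

(** The exponential factors over independent signs: an index in [Q] gives [exp t + exp (-t)], any
    other a factor 2. *)
Lemma random_signs_exp (J : finType) (Q : {set J}) (c : J -> R) (t : R) :
  (forall j, `|c j| = 1) -> 0 <= t -> t ^+ 2 <= 1 / 2 ->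
  \sum_(e : {ffun J -> bool}) expR (t * \sum_(j in Q) sgnb R (e j) * c j) <=
  #|{ffun J -> bool}|%:R * expR (2 * t ^+ 2) ^+ #|Q|.
Proof.
move=> c1 t0 t2.
pose G j b := if j \in Q then expR (t * (sgnb R b * c j)) else 1.
have -> : \sum_(e : {ffun J -> bool}) expR (t * \sum_(j in Q) sgnb R (e j) * c j) =
    \prod_j \sum_b G j b.
  rewrite bigA_distr_bigA; apply: eq_bigr => e _.
  by rewrite mulr_sumr expR_sum /G -big_mkcond.
have -> : #|{ffun J -> bool}|%:R * expR (2 * t ^+ 2) ^+ #|Q| =
    \prod_j (2 * (if j \in Q then expR (2 * t ^+ 2) else 1)) :> R.
  rewrite big_split /= -big_mkcond /= !prodr_const card_ffun card_bool natrX.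
  by congr (_ * _).
apply: ler_prod => j _; rewrite big_bool /G; case: ifP => _; last first.
  by rewrite mulr1 addr_ge0 //= -[2](@natrD _ 1 1).
rewrite addr_ge0 ?expR_ge0 //= /sgnb mul1r mulN1r mulrN.
have := c1 j; have [cj|cj] := ler0P (c j); move=> e.
  have -> : c j = -1 by lra.
  by rewrite mulrN1 opprK expR_pair_le.
by rewrite e mulr1 addrC expR_pair_le.
Qed.

(** Exponential moments and a union bound over [V]: the sum of all exponentials averages at most
    [expR B], so some choice of signs achieves this. The 2 in the hypothesis pays for the two signs
    inside the absolute value. *)
Lemma exists_small_signs (J X : finType) (Q : {set J}) (V : {set X})
    (c : X -> J -> R) (t B : R) :
  (forall x j, `|c x j| = 1) -> 0 <= t -> t ^+ 2 <= 1 / 2 ->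
  2 * #|V|%:R * expR (2 * t ^+ 2) ^+ #|Q| <= expR B ->
  exists e : {ffun J -> bool}, forall x, x \in V ->
    t * `|\sum_(j in Q) sgnb R (e j) * c x j| <= B.
Proof.
move=> c1 t0 t2 hB.
pose P (e : {ffun J -> bool}) x := \sum_(j in Q) sgnb R (e j) * c x j.
pose F (e : {ffun J -> bool}) := \sum_(x in V) (expR (t * P e x) + expR (t * - P e x)).
have sumF : \sum_e F e <= #|{ffun J -> bool}|%:R * expR B.
  rewrite /F exchange_big /=.
  apply: (@le_trans _ _ (\sum_(x in V)
      2 * (#|{ffun J -> bool}|%:R * expR (2 * t ^+ 2) ^+ #|Q|))).
    apply: ler_sum => x _; rewrite big_split /= [2](@natrD _ 1 1) mulrDl mul1r lerD //.
      exact: random_signs_exp.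
    rewrite (eq_bigr (fun e : {ffun J -> bool} =>
        expR (t * \sum_(j in Q) sgnb R (e j) * (- c x j)))).
      by apply: random_signs_exp => // j; rewrite normrN.
    move=> e _; congr (expR (t * _)); rewrite /P -sumrN.
    by apply: eq_bigr => j _; rewrite mulrN.
  rewrite sumr_const -[_ *+ #|V|]mulr_natl.
  set a := #|{ffun _}|%:R; set b := expR _ ^+ _.
  have -> : #|V|%:R * (2 * (a * b)) = a * (2 * #|V|%:R * b) by ring.
  by rewrite ler_wpM2l.
have [e eB] : exists e, F e <= expR B.
  apply: contrapT => none; move: sumF; apply/negP; rewrite -ltNge.
  rewrite mulr_natl -sumr_const; apply: ltr_sum.
    by apply/hasP; exists [ffun=> true]; rewrite ?mem_index_enum.
  by move=> e _; rewrite ltNge; apply/negP => eB; apply: none; exists e.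
exists e => x xV; rewrite -ler_expR; apply: le_trans eB.
rewrite /F (bigD1 x) //= -/(P e x).
have rest : 0 <= \sum_(y in V | y != x) (expR (t * P e y) + expR (t * - P e y)).
  by apply: sumr_ge0 => y _; rewrite addr_ge0 ?expR_ge0.
have := expR_ge0 (t * P e x); have := expR_ge0 (t * - P e x).
by have [_|_] := ler0P (P e x); lra.
Qed.

(** The function depends only on the coordinates in [A], so the union bound runs over [2^n] points
    whatever [N] is. *)
Lemma kahane_salem_zygmund (m n N : nat) (A : {set 'I_N}) :
  (0 < m)%N -> (0 < n)%N -> #|A| = n ->
  exists e : {ffun {set 'I_N} -> bool},
    supnorm (walsh (fun S : {set 'I_N} =>
        if (S \subset A) && (#|S| == m) then sgnb R (e S) else 0)) <=
      6 * n%:R * Num.sqrt (n%:R ^+ m.-1).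
Proof.
move=> m0 n0 An; pose h : R := Num.sqrt (n%:R ^+ m.-1).
have n1 : 1 <= n%:R :> R by rewrite ler1n.
have h2 : h ^+ 2 = n%:R ^+ m.-1 by rewrite sqr_sqrtr // exprn_ge0.
have h1 : 1 <= h ^+ 2 by rewrite h2 exprn_ege1.
have h0 : 0 < h by rewrite sqrtr_gt0 -h2 (lt_le_trans ltr01).
(* As [#|Q| <= n h^2], this [t] gives [2 t^2 #|Q| <= n / 2], and
   [2 * 2^n * exp (n / 2) <= exp (3 n)]; the resulting bound [3 n / t] is [6 n h]. *)
pose t := (2 * h)^-1.
have t0 : 0 < t by rewrite invr_gt0 mulr_gt0.
have t2 : t ^+ 2 * h ^+ 2 = 1 / 4 by rewrite /t; field; rewrite gt_eqF.
pose Q := [set S : {set 'I_N} | (S \subset A) && (#|S| == m)]%SET.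
pose pt (U : {set 'I_N}) : cube N := [ffun i => i \in U].
have Qn : #|Q|%:R <= n%:R * h ^+ 2.
  rewrite h2 -exprS prednK // -natrX ler_nat cards_draws An.
  rewrite (leq_trans (leq_pmulr _ (fact_gt0 m))) // bin_ffact.
  by rewrite ffact_prod -[X in (_ <= _ ^ X)%N]card_ord -prod_nat_const;
     apply: leq_prod => i _; rewrite leq_subr.
have t2h : t ^+ 2 <= 1 / 2.
  by have := ler_wpM2l (sqr_ge0 t) h1; rewrite t2 mulr1; lra.
have small : 2 * #|powerset A|%:R * expR (2 * t ^+ 2) ^+ #|Q| <= expR (3 * n%:R).
  rewrite card_powerset An natrX.
  have e2 : (2 : R) <= expR 1 by have := expR_ge1Dx (1 : R); lra.
  have {}e2 : 2 * 2 ^+ n <= expR (n.+1)%:R :> R.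
    rewrite -exprS -[n.+1%:R]mulr1 expRM_natl.
    by rewrite lerXn2r // nnegrE ?expR_ge0.
  apply: (@le_trans _ _ (expR (n.+1)%:R * expR (n%:R / 2))).
    rewrite -expRM_natl; apply: ler_pM => //; rewrite ?expR_ge0 ?mulr_ge0 ?exprn_ge0 //.
    rewrite ler_expR; have := ler_wpM2l (sqr_ge0 t) Qn.
    by rewrite mulrCA t2; lra.
  by rewrite -expRD ler_expR -natr1; lra.
have [e He] := exists_small_signs (fun U S => normr_chi R S (pt U)) (ltW t0) t2h small.
exists e; apply: supnorm_le => [|x].
  by rewrite !mulr_ge0 ?sqrtr_ge0.
(* [x] is replaced by the point that keeps only its signs on [A]. *)
pose U := [set i in A | x i]%SET.
have UA : U \in powerset A.
  by rewrite powersetE; apply/fintype.subsetP => i; rewrite inE => /andP[].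
have -> : walsh (fun S : {set 'I_N} =>
      if (S \subset A) && (#|S| == m) then sgnb R (e S) else 0) x =
    \sum_(S in Q) sgnb R (e S) * chi R S (pt U).
  rewrite /walsh [RHS]big_mkcond; apply: eq_bigr => S _; rewrite inE.
  case: ifP => [/andP[SA _]|_]; last by rewrite mul0r.
  congr (_ * _); apply: eq_bigr => i iS; rewrite ffunE inE.
  by rewrite (fintype.subsetP SA).
have := He U UA; rewrite /t ler_pdivrMl ?mulr_gt0 // -/h => /le_trans; apply.
by rewrite le_eqVlt; apply/orP; left; apply/eqP; ring.
Qed.

(** Factor by factor, [n <= m (n - i)] for [i < m <= n]. *)
Lemma expn_le_bin (m n : nat) : (0 < m)%N -> (m <= n)%N ->
  (n ^ m <= m ^ m * m`! * 'C(n, m))%N.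
Proof.
move=> m0 mn; rewrite -mulnA [(m`! * _)%N]mulnC bin_ffact ffact_prod.
rewrite -[X in (_ ^ X <= _)%N]card_ord -[X in (_ <= _ ^ X * _)%N]card_ord.
rewrite -!prod_nat_const -big_split /=; apply: leq_prod => i _.
by have := ltn_ord i; nia.
Qed.

(** The random-sign function has coefficients of modulus 1 on the [m]-subsets of the image of [g],
    each contributing at least [s^m]. Comparing ['C(n, m) s^m] with its small norm bounds [s^m] by a
    constant times [n^(-(m-1)/2)]. *)
Lemma mon_level_bound (m : nat) (x : nat -> R) : (0 < m)%N ->
  mon (fun N (f : cube N -> R) => homog m f) x ->
  exists D : R, 0 <= D /\ forall n (g : 'I_n -> nat) (s : R),
    (m <= n)%N -> injective g -> 0 <= s -> (forall i, s < `|x (g i)|) ->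
    s * n%:R `^ ((2 * m)%:R / (m.-1)%:R)^-1 <= D.
Proof.
move=> m0 [C [C0 HC]]; pose k := (m ^ m * m`!)%N.
pose E : R := k%:R * C * 6.
have E0 : 0 <= E by rewrite !mulr_ge0 // ltW.
(* The added 1 gives [E <= (1 + E) ^+ m], so no root of [E] is needed. *)
exists (1 + E); split=> [|n g s mn ginj s0 sx]; first by rewrite addr_ge0.
have n0 : (0 < n)%N by apply: leq_trans mn.
pose N := (\max_i g i)%N.
pose gN i : 'I_N.+1 := inord (g i).
have gNE i : gN i = g i :> nat by rewrite inordK // ltnS; exact: leq_bigmax.
have gNinj : injective gN by move=> i j e; apply: ginj; rewrite -!gNE e.
pose A := [set gN i | i in 'I_n]%SET.
have An : #|A| = n by rewrite card_imset // card_ord.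
have sA i : i \in A -> s <= `|x i|.
  by case/imsetP => l _ ->; rewrite gNE ltW.
have [e He] := kahane_salem_zygmund m0 n0 An.
set a := (fun S => _) in He; set h := Num.sqrt _ in He.
have h2 : h ^+ 2 = n%:R ^+ m.-1 by rewrite sqr_sqrtr // exprn_ge0.
have h0 : 0 < h by rewrite sqrtr_gt0 exprn_gt0 // ltr0n.
have hom : homog m (walsh a).
  by move=> S /eqP/negPf Sm; rewrite fourier_walsh /a Sm andbF.
have lower : 'C(n, m)%:R * s ^+ m <= C * supnorm (walsh a).
  apply: le_trans (HC _ _ hom).
  rewrite -{1}An -cards_draws mulr_natl -sumr_const big_mkcond /=.
  apply: ler_sum => S _; rewrite inE fourier_walsh /a; case: ifP => [/andP[SA /eqP Sm]|_].
    rewrite normrM normr_sgnb mul1r normr_prod -Sm -prodr_const.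
    by apply: ler_prod => i iS; rewrite s0 sA // (fintype.subsetP SA).
  exact: normr_ge0.
have main : n%:R ^+ m * s ^+ m <= n%:R * (E * h).
  apply: (@le_trans _ _ (k%:R * ('C(n, m)%:R * s ^+ m))).
    rewrite mulrA ler_wpM2r ?exprn_ge0 // -natrX -natrM ler_nat.
    exact: expn_le_bin.
  apply: (@le_trans _ _ (k%:R * (C * (6 * n%:R * h)))).
    rewrite ler_wpM2l // (le_trans lower) // ler_wpM2l // ltW //.
  by rewrite le_eqVlt; apply/orP; left; apply/eqP; rewrite /E; ring.
have hs : s ^+ m * h <= E.
  move: main; rewrite -[in n%:R ^+ m](prednK m0) exprS -h2 -mulrA.
  rewrite ler_pM2l ?ltr0n // [E * h]mulrC.
  have -> : h ^+ 2 * s ^+ m = h * (s ^+ m * h) by ring.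
  by rewrite ler_pM2l.
set w := _ `^ _.
have w0 : 0 <= w by exact: powR_ge0.
have wh : w ^+ m = h.
  apply/eqP; rewrite -(eqrXn2 (n := 2)) ?exprn_ge0 ?(ltW h0) //.
  by rewrite -exprM mulnC exprM weight_sqr -exprM mulnC exprM nroot_expn // h2.
rewrite -(ler_pXn2r m0) ?nnegrE ?mulr_ge0 ?addr_ge0 // exprMn wh.
apply: le_trans hs _; apply: (@le_trans _ _ (1 + E)); first by rewrite lerDr.
by rewrite -[leLHS]expr1 ler_weXn2l // lerDl.
Qed.

Lemma unbounded_level (x : nat -> R) (t : R) :
  (forall B, exists k, B < `|x k|) -> forall n,
  exists g : 'I_n -> nat, injective g /\ forall i, t < `|x (g i)|.
Proof.
move=> unb n.
have [s [us ss xs]] : exists s : seq nat,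
    [/\ uniq s, size s = n & forall k, k \in s -> t < `|x k|].
  elim: n => [|n [s [us ss xs]]]; first by exists [::].
  (* Exceeding the sum of the moduli already collected forces [k] to be a new index. *)
  have [k xk] := unb (`|t| + \sum_(l <- s) `|x l|).
  have S0 : 0 <= \sum_(l <- s) `|x l| by apply: sumr_ge0.
  exists (k :: s); split; rewrite /= ?ss //.
    rewrite us andbT; apply/negP => ks; move: xk; apply/negP; rewrite -leNgt.
    rewrite (big_rem k) //= addrCA lerDl addr_ge0 //; exact: sumr_ge0.
  move=> l; rewrite inE => /predU1P[->|/xs //].
  by apply: le_lt_trans xk; rewrite (le_trans (ler_norm t)) // lerDl.
exists (fun i : 'I_n => nth 0%N s i); split=> [i j /eqP|i].
  by rewrite nth_uniq ?ss // => /eqP/ord_inj.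
by apply: xs; rewrite mem_nth // ss.
Qed.

(** The level bound concerns only [n >= m], so boundedness of [x] comes first: it settles [m = 1]
    and covers the ranks [n < m]. *)
Lemma mon_sub_target (m : nat) (x : nat -> R) : (0 < m)%N ->
  mon (fun N (f : cube N -> R) => homog m f) x -> target m x.
Proof.
move=> m0 /(mon_level_bound m0)[D [D0 HD]].
pose q : R := (2 * m)%:R / (m.-1)%:R.
have q0 : 0 <= q^-1 by rewrite invr_ge0 divr_ge0.
pose w n : R := n%:R `^ q^-1.
have wn1 n : (0 < n)%N -> 1 <= w n.
  move=> n0; have <- : w 1%N = 1 by rewrite /w powR1.
  by apply: ge0_ler_powR; rewrite ?nnegrE // ler_nat.
have [B HB] : exists B, forall k, `|x k| <= B.
  apply: contrapT => nB.
  have [|g [ginj xg]] := unbounded_level (x := x) (D + 1) _ m.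
    move=> B; apply: contrapT => nk; apply: nB; exists B => k.
    by rewrite leNgt; apply/negP => Bk; apply: nk; exists k.
  have D1 : 0 <= D + 1 by rewrite addr_ge0.
  have := HD m g _ (leqnn m) ginj D1 xg; rewrite -/(w m).
  apply/negP; rewrite -ltNge (lt_le_trans (y := D + 1)) ?ltrDl //.
  by rewrite ler_peMr // wn1.
have B0 : 0 <= B by apply: le_trans (HB 0%N).
rewrite /target; case: eqP => [_|_]; first by exists B.
exists (w m * B + (D + 1)) => n n0; rewrite -/q -/(w n).
have w0 : 0 < w n by apply: lt_le_trans (wn1 n n0).
(* An admissible level in the infimum defining [xstar]; taking [D + 1] rather than [D] makes the
   level bound contradictory. *)
pose s := if (n < m)%N then B else (D + 1) / w n.
have s0 : 0 <= s by rewrite /s; case: ifP => // _; rewrite divr_ge0 ?addr_ge0 // ltW.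
apply: (@le_trans _ _ ((w n)%:E * s%:E)%E).
  apply: lee_wpmul2l; first by rewrite lee_fin ltW.
  apply: ereal_inf_lbound; exists s => //; split=> //= -[g [ginj xg]].
  move: xg; rewrite {1}/s; case: ltnP => [_|mn] xg.
    by have := xg (Ordinal n0); rewrite /= ltNge HB.
  have D1 : 0 <= (D + 1) / w n by rewrite divr_ge0 ?addr_ge0 // ltW.
  have := HD n g _ mn ginj D1 xg; rewrite -/(w n) divfK ?gt_eqF //.
  by apply/negP; rewrite -ltNge ltrDl.
rewrite -EFinM lee_fin /s; case: ltnP => [nm|mn].
  rewrite -[leLHS]addr0 lerD ?addr_ge0 // ler_wpM2r //.
  by apply: ge0_ler_powR; rewrite ?nnegrE // ler_nat ltnW.
rewrite mulrCA divff ?gt_eqF // mulr1 lerDr mulr_ge0 //; exact: powR_ge0.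
Qed.

End LowerInclusion.

(** * Closing the cycle of inclusions *)

Theorem theorem6p11 (R : realType) (m : nat) (hm : (0 < m)%N) :
  mon (fun N (f : cube N -> R) => homog m f) = @target R m /\
  mon (fun N (f : cube N -> R) => deg_le m f) = @target R m.
Proof.
(* [mon] reverses inclusions of function classes, so the two inclusions already proved yield both
   equalities. *)
have sub x : mon (fun N (f : cube N -> R) => deg_le m f) x ->
    mon (fun N (f : cube N -> R) => homog m f) x.
  move=> [C [C0 HC]]; exists C; split=> // N f fm; apply: HC => S mS.
  by apply: fm => e; rewrite e ltnn in mS.
split; apply/seteqP; split=> x.
- exact: mon_sub_target.
- by move=> /(target_sub_mon hm)/sub.
- by move=> /sub; exact: mon_sub_target.
- exact: target_sub_mon.
Qed.
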